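(* Let $Q^f$ be a kernel operator on $\mathcal{X}$ satisfying Assumptions 1, 2 and 3, let $\Lambda>0$ be its spectral radius on $L^\infty_W(\mathcal{X})$, $\lambda=\log\Lambda$, and let $\mu_f^*$ be the unique fixed point of the Feynman–Kac map $\Phi$ with $\mu_f^*(W)<+\infty$. Then for every $\mu\in\mathcal{P}(\mathcal{X})$ with $\mu(W)<+\infty$, $$\lambda=\lim_{k\to+\infty}\frac1k\log\Big(\mu\big[(Q^f)^k\mathbb{1}\big]\Big),$$ and moreover $\Lambda=\mu_f^*(Q^f\mathbb{1})$.
   Context: $\mathcal{X}$ is a Polish space and $\mathcal{P}(\mathcal{X})$ denotes the set of probability measures on $\mathcal{X}$. A kernel operator $Q^f$ on $\mathcal{X}$ is a map such that for every $x\in\mathcal{X}$, $Q^f(x,\cdot)$ is a positive measure of finite mass, and for every measurable $A\subset\mathcal{X}$, $x\mapsto Q^f(x,A)$ is measurable; one writes $(Q^f\varphi)(x)=\int_{\mathcal{X}}\varphi(y)\,Q^f(x,dy)$, $\mu(\varphi)=\int\varphi\,d\mu$, and $\mathbb{1}$ for the constant function $1$. $(K_n)_{n\geq1}$ is a fixed increasing sequence of compact subsets of $\mathcal{X}$ such that every compact $K\subset\mathcal{X}$ is contained in some $K_m$. For $W:\mathcal{X}\to[1,+\infty)$, $L^\infty_W(\mathcal{X})$ is the Banach space of measurable $\varphi$ with $\|\varphi\|_{L^\infty_W}:=\sup_{x}|\varphi(x)|/W(x)<+\infty$. The one-step Feynman–Kac map is $\Phi(\mu)(\varphi)=\mu(Q^f\varphi)/\mu(Q^f\mathbb{1})$.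 The spectral radius of $Q^f$ on $L^\infty_W$ is $\Lambda=\lim_k\|(Q^f)^k\|^{1/k}$. Assumption 1 (Lyapunov): there exist $W:\mathcal{X}\to[1,+\infty)$ bounded on compact sets and positive sequences $(\gamma_n)_{n\ge1}$, $(b_n)_{n\ge1}$ with $\gamma_n\to0$ such that for all $n\geq1$, $Q^fW\leq \gamma_n W+b_n\mathbb{1}_{K_n}$ pointwise. Assumption 2 (minorization and irreducibility): for each $n\geq1$ there exist $\eta_n\in\mathcal{P}(\mathcal{X})$ and $\alpha_n>0$ such that $Q^f(x,\cdot)\geq\alpha_n\eta_n(\cdot)$ (as measures) for all $x\in K_n$; moreover, for any $n_0\geq1$ and any $\varphi\in L^\infty_W(\mathcal{X})$ with $\varphi\geq0$, if $\eta_n(\varphi)=0$ for all $n\geq n_0$, then $(Q^f\varphi)(x)=0$ for all $x\in\mathcal{X}$. Assumption 3 (local regularity): for every $n\geq1$ and every measurable function $\varphi$ bounded on $K_n$, the function $Q^f(\varphi\mathbb{1}_{K_n})$ is continuous on $K_n$. *)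

(* Defs.v *)
From HB Require Import structures.
From mathcomp Require Import all_boot all_order all_algebra.
From mathcomp Require Import all_classical all_reals all_analysis.
Set Implicit Arguments. Unset Strict Implicit. Unset Printing Implicit Defensive.
Import Order.TTheory GRing.Theory Num.Theory.
Import numFieldNormedType.Exports.
Local Open Scope classical_set_scope.
Local Open Scope ring_scope.

Definition polish (R : realType) (T : ptopologicalType) : Prop :=
  (exists D : set T, countable D /\ closure D = setT) /\
  exists dist : T -> T -> R,
    (forall x y, 0 <= dist x y) /\
        (forall x y, dist x y = 0 <-> x = y) /\
        (forall x y, dist x y = dist y x) /\
        (forall x y z, dist x z <= dist x y + dist y z) /\
        (forall A : set T, open A <->
            (forall x, A x -> exists2 e : R, 0 < e & [set y | dist x y < e] `<=` A)) /\
        (forall u : nat -> T,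
            (forall e : R, 0 < e -> exists N, forall m n, (N <= m)%N -> (N <= n)%N ->
                 dist (u m) (u n) < e) ->
            exists l : T, u @ \oo --> l).

Definition borel (T : ptopologicalType) : measurableType ((@open T).-sigma) :=
  g_sigma_algebraType (@open T).

Section FK.
Context {R : realType} {d : measure_display} {X : measurableType d}.
Local Open Scope ereal_scope.

Definition Qapp (Q : R.-ker X ~> X) (f : X -> \bar R) : X -> \bar R :=
  fun x => \int[Q x]_y f y.

Definition Qpow (Q : R.-ker X ~> X) (k : nat) (f : X -> \bar R) : X -> \bar R :=
  iter k (Qapp Q) f.

Definition normW (W : X -> R) (f : X -> \bar R) : \bar R :=
  ereal_sup [set `|f x| * ((W x)^-1)%:E | x in [set: X]].

Definition inLW (W : X -> R) (phi : X -> R) : Prop :=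
  measurable_fun [set: X] phi /\
  exists c : R, forall x, (`|phi x| <= c * W x)%R.

Definition opnormW (Q : R.-ker X ~> X) (W : X -> R) (k : nat) : \bar R :=
  ereal_sup [set normW W (Qpow Q k (EFin \o phi)) |
             phi in [set phi | inLW W phi /\ normW W (EFin \o phi) <= 1]].

End FK.

(* Main.v *)
Require Import Defs.
From HB Require Import structures.
From mathcomp Require Import all_boot all_order all_algebra.
From mathcomp Require Import all_classical all_reals all_analysis.
From mathcomp Require Import measurable_realfun ring lra.
Set Implicit Arguments. Unset Strict Implicit. Unset Printing Implicit Defensive.
Import Order.TTheory GRing.Theory Num.Theory.
Import numFieldNormedType.Exports.
Local Open Scope classical_set_scope.
Local Open Scope ring_scope.

(** Write [pi] for the fixed point [mustar] and [theta = pi (Q 1)], so that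
    [pi Q = theta pi]. Minorization and irreducibility give [Q(x, .) << pi] for
    every [x]; by local regularity and Dini's theorem this absolute continuity
    is uniform for [x] in each [K n]. Together with the Lyapunov condition it
    yields [Q^k W <= S theta^k W] for a constant [S]. Conversely
    [pi (Q^k W) = theta^k pi (W)], so the norm of [Q^k] lies between [theta^k]
    and [S theta^k], and [Lambda = theta]. This argument replaces the
    Krein-Rutman theorem. Minorization and irreducibility also bound
    [mu (Q^k 1)] below by [c theta^k], because [theta^-k Q^k 1] has
    [pi]-integral [1] and is dominated by [S W]. *)

(** * Positivity and measurability of the iterated kernel operator *)

Section kernel_operator.
Context {R : realType} {d : measure_display} {X : measurableType d}.
Context (Q : R.-ker X ~> X).
Local Open Scope ereal_scope.
Implicit Types f g : X -> \bar R.

Lemma Qapp_ge0 f : (forall x, 0 <= f x) -> forall x, 0 <= Qapp Q f x.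
Proof. by move=> f0 x; exact: integral_ge0. Qed.

Lemma measurable_Qapp f :
  measurable_fun [set: X] f -> measurable_fun [set: X] (Qapp Q f).
Proof.
move=> mf; rewrite /Qapp; under eq_fun do rewrite integralE.
apply: emeasurable_funB; apply: measurable_fun_integral_kernel => //.
- by move=> U mU; exact: measurable_kernel.
- exact: measurable_funepos.
- by move=> U mU; exact: measurable_kernel.
- exact: measurable_funeneg.
Qed.

Lemma le_Qapp f g : measurable_fun [set: X] f -> measurable_fun [set: X] g ->
  (forall x, 0 <= f x) -> (forall x, f x <= g x) ->
  forall x, Qapp Q f x <= Qapp Q g x.
Proof. by move=> mf mg f0 fg x; apply: ge0_le_integral. Qed.

Lemma QappZ (c : R) f : measurable_fun [set: X] f -> (forall x, 0 <= f x) ->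
  (0 <= c)%R -> forall x, Qapp Q (fun y => c%:E * f y) x = c%:E * Qapp Q f x.
Proof. by move=> mf f0 c0 x; rewrite /Qapp ge0_integralZl// lee_fin. Qed.

Lemma Qpow_ge0 k f : (forall x, 0 <= f x) -> forall x, 0 <= Qpow Q k f x.
Proof. by move=> f0; elim: k => //= k ih; exact: Qapp_ge0. Qed.

Lemma measurable_Qpow k f :
  measurable_fun [set: X] f -> measurable_fun [set: X] (Qpow Q k f).
Proof. by move=> mf; elim: k => //= k ih; exact: measurable_Qapp. Qed.

Lemma le_Qpow k f g : measurable_fun [set: X] f -> measurable_fun [set: X] g ->
  (forall x, 0 <= f x) -> (forall x, f x <= g x) ->
  forall x, Qpow Q k f x <= Qpow Q k g x.
Proof.
move=> mf mg f0 fg; elim: k => //= k ih.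
by apply: le_Qapp ih; [exact: measurable_Qpow..|exact: Qpow_ge0].
Qed.

Lemma le_abse_Qpow k f x : measurable_fun [set: X] f ->
  `|Qpow Q k f x| <= Qpow Q k (abse \o f) x.
Proof.
move=> mf; elim: k x => //= k ih x.
apply: le_trans (le_abse_integral _ _ _) _ => //; first exact: measurable_Qpow.
apply: ge0_le_integral => //.
- by apply: measurableT_comp => //; exact: measurable_Qpow.
- by apply: measurable_Qpow; exact: measurableT_comp.
Qed.

End kernel_operator.

(** * Integration against mixtures of kernels and stationary measures *)

Section integral_against_kernel.
Context {R : realType} {d d' : measure_display}.
Context {X : measurableType d} {Y : measurableType d'}.
Context (mu : {measure set X -> \bar R}) (nu : {measure set Y -> \bar R}).
Context (Q : R.-ker X ~> Y).
Local Open Scope ereal_scope.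
Import HBNNSimple.

Let integral_kernel_nnsfun (f : {nnsfun Y >-> R}) :
  (forall A, measurable A -> nu A = \int[mu]_x Q x A) ->
  \int[nu]_y (f y)%:E = \int[mu]_x \int[Q x]_y (f y)%:E.
Proof.
move=> nuE.
have intf (m : {measure set Y -> \bar R}) : \int[m]_y (f y)%:E =
    \sum_(r \in range f) (r%:E * m (f @^-1` [set r])).
  by rewrite integralT_nnsfun sintegralE.
rewrite intf; under [RHS]eq_integral do rewrite intf.
have f0 r : range f r -> (0 <= r)%R by move=> [y _ <-].
(* [Num.max r 0] agrees with [r] on the range of [f] and makes the summand nonnegative for arbitrary
   [r], as the exchange of integral and sum requires. *)
rewrite [RHS](_ : _ = \int[mu]_x \sum_(r \in range f)
    ((Num.max r 0)%:E * Q x (f @^-1` [set r]))); last first.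
  apply: eq_integral => x _; apply: eq_fsbigr => r; rewrite inE => /f0 r0.
  by rewrite (max_idPl r0).
rewrite ge0_integral_fsum//; last 2 first.
- by move=> r; apply: measurable_funeM; exact: measurable_kernel.
- by move=> r x _; rewrite mule_ge0// lee_fin le_max lexx orbT.
apply: eq_fsbigr => r; rewrite inE => /f0 r0.
rewrite ge0_integralZl//; last 2 first.
- exact: measurable_kernel.
- by rewrite lee_fin le_max lexx orbT.
by rewrite (max_idPl r0) nuE.
Qed.

(** Simple functions are handled by linearity; monotone convergence then passes to the limit on the
    left, in the inner integral and in the outer one. *)
Lemma ge0_integral_kernel (f : Y -> \bar R) :
  (forall A, measurable A -> nu A = \int[mu]_x Q x A) ->
  (forall y, 0 <= f y) -> measurable_fun [set: Y] f ->
  \int[nu]_y f y = \int[mu]_x \int[Q x]_y f y.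
Proof.
move=> nuE f0 mf.
pose f_ := nnsfun_approx measurableT mf.
have mf_ n : measurable_fun [set: Y] (EFin \o f_ n) by exact/measurable_EFinP.
have f_0 n y : 0 <= (f_ n y)%:E by rewrite lee_fin.
have ndf_ y : {homo (fun n => (f_ n y)%:E) : a b / (a <= b)%N >-> a <= b}.
  by move=> a b ab; rewrite lee_fin; exact/lefP/nd_nnsfun_approx.
have limf (m : {measure set Y -> \bar R}) :
    \int[m]_y f y = limn (fun n => \int[m]_y (f_ n y)%:E).
  rewrite -monotone_convergence//.
  by apply: eq_integral => y _; apply/esym/cvg_lim => //; exact: cvg_nnsfun_approx.
rewrite limf; under eq_fun do rewrite integral_kernel_nnsfun//.
under [RHS]eq_integral do rewrite limf.
rewrite monotone_convergence//.
- move=> n; apply: measurable_fun_integral_kernel => //.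
    by move=> U mU; exact: measurable_kernel.
  exact: mf_.
- by move=> n x _; exact: integral_ge0.
- move=> x _ a b ab; apply: ge0_le_integral => //; [exact: mf_..|].
  by move=> y _; exact: ndf_.
Qed.

End integral_against_kernel.

(** The hypothesis makes [theta * mu] the mixture of the measures [Q x] under [mu], so
    [ge0_integral_kernel] applied to this scaled measure extracts one factor [theta] per application
    of [Q]. *)
Lemma integral_Qpow {R : realType} {d : measure_display} {X : measurableType d}
  (Q : R.-ker X ~> X) (mu : {measure set X -> \bar R}) (theta : R) :
  0 <= theta ->
  (forall A, measurable A -> (theta%:E * mu A = \int[mu]_x Q x A)%E) ->
  forall k (f : X -> \bar R), (forall x, 0 <= f x)%E ->
  measurable_fun [set: X] f ->
  (\int[mu]_x Qpow Q k f x = (theta ^+ k)%:E * \int[mu]_x f x)%E.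
Proof.
move=> theta0 muQ k f f0 mf; elim: k => [|k ih]; first by rewrite expr0 mul1e.
rewrite exprS EFinM -muleA -ih.
have th0 : 0 <= theta by [].
rewrite -[in RHS](ge0_integral_mscale _ _ (NngNum th0))//=; last 2 first.
- exact: measurable_Qpow.
- by move=> x _; exact: Qpow_ge0.
apply/esym/ge0_integral_kernel => //.
- by move=> x; exact: Qpow_ge0.
- exact: measurable_Qpow.
Qed.

(** * Uniform absolute continuity of the kernel on compact sets *)

(* If the bound failed along sets [A_n] with [mu (A_n) <= 2^-(n+1)], the tails
   [\bigcup_(j >= n) A_j] would decrease to a null set, and Dini's theorem on
   the compact set would make their [Q]-mass uniformly small. *)
Lemma kernel_uniformly_absolutely_continuous {R : realType}
    {T : ptopologicalType} (Q : R.-ker (borel T) ~> (borel T))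
    (mu : {measure set (borel T) -> \bar R}) (C : set T) :
  compact C -> (measurable : set (set (borel T))) C ->
  (forall x, (Q x setT < +oo)%E) ->
  (forall A : set (borel T), measurable A ->
    {within C, continuous (fun x : T => fine (Q x (A `&` C)))}) ->
  (forall A : set (borel T), measurable A -> mu A = 0%E ->
    forall x, Q x A = 0%E) ->
  forall e : R, 0 < e -> exists2 delta : R, 0 < delta &
    forall A : set (borel T), measurable A -> (mu A <= delta%:E)%E ->
    forall x, C x -> (Q x (A `&` C) <= e%:E)%E.
Proof.
move=> cC mC Qfin Qcont Qmu e e0; apply: contrapT => nodelta.
have [|A AP] := @choice nat (set (borel T)) (fun n B =>
    [/\ measurable B, (mu B <= (1 / (2 ^ n.+1)%:R)%:E)%E &
      exists2 x, C x & (e%:E < Q x (B `&` C))%E]).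
  move=> n; apply: contrapT => noA; apply: nodelta.
  exists (1 / (2 ^ n.+1)%:R); first by rewrite divr_gt0// ltr0n expn_gt0.
  move=> B mB Bn x Cx; rewrite leNgt; apply/negP => eB; apply: noA.
  by exists B; split => //; exists x.
have mA n : measurable (A n) by have [] := AP n.
pose B n := \bigcup_(j in [set j | (n <= j)%N]) A j.
have mB n : measurable (B n) by apply: bigcup_measurable => j _; exact: mA.
have QfinA x D : measurable D -> (Q x D < +oo)%E.
  by move=> mD; apply: le_lt_trans (Qfin x); rewrite le_measure// inE.
have mulimA : mu (lim_sup_set A) = 0%E.
  apply: lim_sup_set_cvg0 => //.
  apply: (@le_lt_trans _ _ (\sum_(n <oo) (1 / (2 ^ n.+1)%:R : R)%:E)%E).
    by apply: lee_nneseries => n _; have [] := AP n.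
  by apply: le_lt_trans (epsilon_trick0 _ _) _; rewrite ?ltry.
have mlimA : measurable (lim_sup_set A).
  by apply: bigcap_measurable => // n _; exact: mB.
(* The limsup set is [mu]-null by Borel-Cantelli, hence [Q x]-null for every [x], and continuity
   from above sends the mass of the tails to zero. *)
have Qlim x : Q x (B n) @[n --> \oo] --> 0%E.
  have := lim_sup_set_cvg (Q x) A mA.
  by rewrite (Qmu _ mlimA mulimA); apply; apply: QfinA; exact: (mB 0%N).
move: (cC) => /compact_near_coveringP/near_covering_withinP.
move=> /(_ _ _ (fun n x => (Q x (B n `&` C) < e%:E)%E) (eventually_filter)).
move=> /(_ _)[|N _ /(_ N (leqnn N)) BN].
  move=> x Cx.
  have [N _ QN] : \forall n \near \oo, (Q x (B n) < e%:E)%E.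
    apply: (Qlim x [set y | (y < e%:E)%E]).
    by apply: open_ereal_lt'; rewrite lte_fin.
  have QxN : fine (Q x (B N `&` C)) < e.
    rewrite -lte_fin fineK ?ge0_fin_numE// ?QfinA//; last exact: measurableI.
    apply: le_lt_trans (QN N (leqnn N)).
    by rewrite le_measure ?inE//; exact: measurableI.
  (* Continuity within [C] spreads the strict bound at [x] to a neighbourhood, and monotonicity of
     the tails extends it to all [i >= N]; compactness then yields one index for the whole of
     [C]. *)
  have := Qcont _ (mB N); move/subspace_continuousP => /(_ x Cx).
  move/cvgr_lt => /(_ _ QxN); rewrite /within/= => Qnear.
  exists ([set x' : T | C x' -> fine (Q x' (B N `&` C)) < e], [set i | (N <= i)%N]).
    by split => //; exists N.
  move=> [x' i] /= [Qx' Ni] Cx'.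
  apply: le_lt_trans (_ : Q x' (B N `&` C) < _)%E.
    rewrite le_measure ?inE//; [exact: measurableI..|].
    by apply: setSI => y [j /= ij Ajy]; exists j => //=; exact: leq_trans ij.
  by have := Qx' Cx'; rewrite -lte_fin fineK// ge0_fin_numE// QfinA//; exact: measurableI.
have [_ _ [x Cx]] := AP N; apply/negP; rewrite -leNgt; apply/ltW.
apply: le_lt_trans (BN _ Cx).
rewrite le_measure ?inE//; [exact: measurableI..|].
by apply: setSI => y AN; exists N => /=.
Qed.

(** * Upper bound on the growth of [Q^k W] *)

Lemma le_Qapp_scale {R : realType} {d : measure_display} {X : measurableType d}
    (Q : R.-ker X ~> X) (W : X -> R) (f : X -> \bar R) (c : R) :
  measurable_fun [set: X] W -> (forall x, 0 <= W x) -> 0 <= c ->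
  measurable_fun [set: X] f -> (forall x, 0 <= f x)%E ->
  (forall x, f x <= (c * W x)%:E)%E ->
  forall x, (Qapp Q f x <= c%:E * Qapp Q (EFin \o W) x)%E.
Proof.
move=> mW W0 c0 mf f0 fW x.
have mEW : measurable_fun [set: X] (EFin \o W) by exact/measurable_EFinP.
rewrite -QappZ//.
apply: le_Qapp => //; exact: measurable_funeM.
Qed.

Section growth.
Context {R : realType} {d : measure_display} {X : measurableType d}.
Context (Q : R.-ker X ~> X) (mu : {measure set X -> \bar R}).
Context (W : X -> R) (K : nat -> set X) (gamma b : nat -> R) (theta : R).

(* Two-step induction on [k]: a value of [f := Q^{k+1} W] is either taken outside [K m],
   where the Lyapunov bound makes it small relative to [W], or below the level
   [M theta^{k+1}], or on a set of small [mu]-measure by Markov's inequality,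
   which [Q x] barely charges for [x] in [K m]. *)
Lemma Qpow_growth : 0 < theta ->
  measurable_fun [set: X] W -> (forall x, 1 <= W x) ->
  (forall n, measurable (K n)) ->
  (forall n, exists M : R, forall x, K n x -> W x <= M) ->
  (forall n, 0 < gamma n) -> (forall n, 0 < b n) -> gamma @ \oo --> 0 ->
  (forall n x,
    (Qapp Q (EFin \o W) x <= (gamma n * W x + b n * \1_(K n) x)%:E)%E) ->
  (\int[mu]_x (W x)%:E < +oo)%E ->
  (forall A, measurable A -> (theta%:E * mu A = \int[mu]_x Q x A)%E) ->
  (forall n (e : R), 0 < e -> exists2 delta : R, 0 < delta &
    forall A, measurable A -> (mu A <= delta%:E)%E ->
    forall x, K n x -> (Q x (A `&` K n) <= e%:E)%E) ->
  exists2 S : R, 0 < S &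
    forall k x, (Qpow Q k (EFin \o W) x <= (S * theta ^+ k * W x)%:E)%E.
Proof.
move=> th0 mW W1 mK WK g0 b0 gcvg lyap muW muQ uac.
have W0 x : 0 <= W x by exact: le_trans (W1 x).
have mEW : measurable_fun [set: X] (EFin \o W) by exact/measurable_EFinP.
have EW0 x : (0 <= (EFin \o W) x)%E by rewrite lee_fin.
(* Since [1 <= W], the Lyapunov inequality for [n = 0] alone gives [Q W <= c W]. *)
pose c := gamma 0 + b 0%N.
have c0 : 0 < c by rewrite addr_gt0.
have QWc x : (Qapp Q (EFin \o W) x <= (c * W x)%:E)%E.
  apply: le_trans (lyap 0%N x) _; rewrite lee_fin mulrDl lerD2l.
  rewrite ler_pM2l// (le_trans _ (W1 x))// indicE; by case: (_ \in _).
(* [gm1] settles the points outside [K m]. On [K m] three contributions share the target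
   [S theta^(k+2) W]: [gm2] limits the first to a quarter, the level [M] takes a half, and the small
   set, through [theta / (4 * w)], the last quarter. *)
have [m gm1 gm2] : exists2 m, gamma m <= theta & gamma m * c <= theta ^+ 2 / 4.
  have e0 : 0 < Num.min theta (theta ^+ 2 / 4 / c).
    by rewrite lt_min th0/= !divr_gt0// exprn_gt0.
  move/cvgr_lt : gcvg => /(_ _ e0) [m _ /(_ m (leqnn m))]/=.
  rewrite lt_min => /andP[g1 g2]; exists m; first exact: ltW.
  by rewrite -ler_pdivlMr// ltW.
have [w w0 Ww] : exists2 w : R, 0 < w & forall x, K m x -> W x <= w.
  have [w Ww] := WK m; exists (Num.max 1 w); first by rewrite lt_max ltr01.
  by move=> x /Ww Wxw; rewrite le_max Wxw orbT.
have e0 : 0 < theta / (4 * w) by rewrite divr_gt0// mulr_gt0.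
have [delta delta0 Qdelta] := uac m _ e0.
pose I := fine (\int[mu]_x (W x)%:E).
have I0 : 0 <= I by apply/fine_ge0/integral_ge0 => x _; rewrite lee_fin.
have IE : (\int[mu]_x (W x)%:E = I%:E)%E.
  by rewrite fineK// ge0_fin_numE// integral_ge0// => x _; rewrite lee_fin.
(* By Markov's inequality the set where [Q^(k+1) W >= M theta^(k+1)] has [mu]-mass at most
   [I / M <= delta]; adding [1] keeps [M] positive even if [I] vanishes. *)
pose M := I / delta + 1.
have M0 : 0 < M by rewrite ltr_wpDl// divr_ge0// ltW.
have IM : I <= M * delta by rewrite mulrDl divfK ?gt_eqF// mul1r lerDl ltW.
(* The three terms serve the base cases [k = 0] and [k = 1] and the absorption of the level [M] in
   the induction step. *)
pose S := 1 + c / theta + 2 * M * c / theta.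
have S0 : 0 < S by rewrite !addr_gt0// divr_gt0// !mulr_gt0.
have cth : 0 <= c / theta by rewrite divr_ge0// ltW.
have Mcth : 0 <= 2 * M * c / theta by rewrite divr_ge0 ?mulr_ge0// ltW.
have S1 : 1 <= S by rewrite /S; lra.
have Sc : c / theta <= S by rewrite /S; lra.
have SM : 2 * M * c / theta <= S by rewrite /S; lra.
clearbody S M I c; exists S => //.
suff H k : (forall x, Qpow Q k (EFin \o W) x <= (S * theta ^+ k * W x)%:E)%E /\
    (forall x, Qpow Q k.+1 (EFin \o W) x <= (S * theta ^+ k.+1 * W x)%:E)%E.
  by move=> k; have [] := H k.
elim: k => [|k [ihk ihk1]].
  split=> x; first by rewrite lee_fin expr0 mulr1 ler_peMl.
  apply: le_trans (QWc x) _; rewrite lee_fin expr1 ler_wpM2r//.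
  by rewrite -ler_pdivrMr.
split=> // x.
set f := Qpow Q k.+1 (EFin \o W) in ihk1 *.
have f0 y : (0 <= f y)%E by exact: Qpow_ge0.
have mf : measurable_fun [set: X] f by exact: measurable_Qpow.
have thk j : 0 < theta ^+ j by exact: exprn_gt0.
have Sk j : 0 <= S * theta ^+ j by rewrite mulr_ge0// ltW.
change (Qapp Q f x <= (S * theta ^+ k.+2 * W x)%:E)%E.
have [Kx|Kx] := pselect (K m x); last first.
  apply: le_trans (le_Qapp_scale Q mW W0 (Sk k.+1) mf f0 ihk1 x) _.
  apply: le_trans (lee_wpmul2l _ (lyap m x)) _; first by rewrite lee_fin.
  rewrite -EFinM lee_fin indicE memNset// mulr0 addr0 mulrA ler_wpM2r//.
  by rewrite (exprS theta k.+1) (mulrC theta) mulrA ler_wpM2l.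
pose A := [set y | ((M * theta ^+ k.+1)%:E <= f y)%E].
have mA : measurable A.
  by have := emeasurable_fun_c_infty measurableT mf (M * theta ^+ k.+1)%:E; rewrite setTI.
have muA : (mu A <= delta%:E)%E.
  have := le_integral_abse mu measurableT mf (mulr_gt0 M0 (thk k.+1)).
  under eq_integral do rewrite gee0_abs//.
  rewrite (@integral_Qpow _ _ _ Q mu theta (ltW th0) muQ)// IE setTI.
  rewrite (_ : [set _ | _] = A); last by apply/funext => y; rewrite /A/= gee0_abs.
  move=> markov; rewrite -(@lee_pmul2l _ (M * theta ^+ k.+1)%:E)//.
    apply: le_trans markov _; rewrite -!EFinM lee_fin mulrAC (mulrC _ I).
    by rewrite ler_wpM2r// ltW.
  by rewrite lte_fin mulr_gt0.
(* Three regions: outside [K m] the Lyapunov bound is combined with the estimate of the earlier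
   iterate [Q^k W], which is why the induction carries two steps; on the part of [A] in [K m] the
   later estimate holds with [W <= w]; elsewhere [f] is below its level and [1 <= W]. *)
have fA y : (f y <= ((S * theta ^+ k * gamma m + M * theta ^+ k.+1) * W y +
   S * theta ^+ k.+1 * w * \1_(A `&` K m) y)%:E)%E.
  have [Ky|Ky] := pselect (K m y); last first.
    apply: le_trans (le_Qapp_scale Q mW W0 (Sk k) (measurable_Qpow Q k mEW)
      (Qpow_ge0 Q k EW0) ihk y) _.
    apply: le_trans (lee_wpmul2l _ (lyap m y)) _; first by rewrite lee_fin.
    rewrite -EFinM lee_fin (indicE _ (K m)) memNset// mulr0 addr0 mulrA.
    by rewrite mulrDl -addrA lerDl addr_ge0// mulr_ge0 ?ler0n ?mulr_ge0// ltW.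
  have [Ay|Ay] := pselect (A y).
    apply: le_trans (ihk1 y) _; rewrite lee_fin indicE mem_set// mulr1.
    rewrite ler_wpDl// ?mulr_ge0// ?ler_wpM2l ?Ww//.
    by rewrite addr_ge0// mulr_ge0// ltW.
  have : (f y < (M * theta ^+ k.+1)%:E)%E by rewrite ltNge; exact/negP.
  move=> /ltW/le_trans; apply; rewrite lee_fin mulrDl -addrA addrCA ler_wpDr//.
    by rewrite addr_ge0// ?mulr_ge0// ?ler0n// ltW.
  by rewrite ler_peMr// mulr_ge0// ltW.
have mAK : measurable (A `&` K m) by exact: measurableI.
set c1 := S * theta ^+ k * gamma m + M * theta ^+ k.+1 in fA.
set c2 := S * theta ^+ k.+1 * w in fA.
have c10 : 0 <= c1 by rewrite addr_ge0// mulr_ge0// ltW.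
have c20 : 0 <= c2 by rewrite mulr_ge0// ltW.
have m1 : measurable_fun [set: X] (fun y => (\1_(A `&` K m) y)%:E : \bar R).
  by apply/measurable_EFinP; exact: measurable_indic.
have Qf : (Qapp Q f x <= (c1 * (c * W x) + c2 * (theta / (4 * w)))%:E)%E.
  apply: (@le_trans _ _ (\int[Q x]_y (c1%:E * (W y)%:E +
      c2%:E * (\1_(A `&` K m) y)%:E)))%E.
    apply: ge0_le_integral => //.
    by apply: emeasurable_funD; exact: measurable_funeM.
  rewrite ge0_integralD//; last 4 first.
  - by move=> y _; rewrite -EFinM lee_fin mulr_ge0.
  - exact: measurable_funeM.
  - by move=> y _; rewrite -EFinM lee_fin mulr_ge0.
  - exact: measurable_funeM.
  rewrite !ge0_integralZl// ?lee_fin//; last by move=> y _; rewrite lee_fin.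
  rewrite (EFinD (c1 * _)) (EFinM c1) (EFinM c2).
  apply: leeD; apply: lee_wpmul2l; rewrite ?lee_fin//; first exact: QWc.
  by rewrite integral_indic// setIT; exact: Qdelta.
apply: le_trans Qf _; rewrite lee_fin.
have -> : c2 * (theta / (4 * w)) = S * theta ^+ k.+2 / 4.
  by rewrite /c2 !exprS; field; rewrite gt_eqF.
have c1c : c1 * c <= S * theta ^+ k.+2 * (3 / 4).
  have -> : c1 * c = S * theta ^+ k * (gamma m * c) + M * c * theta ^+ k.+1.
    by rewrite /c1; ring.
  have : S * theta ^+ k * (gamma m * c) <= S * theta ^+ k * (theta ^+ 2 / 4).
    by rewrite ler_wpM2l.
  have : M * c * theta ^+ k.+1 <= S * theta / 2 * theta ^+ k.+1.
    rewrite ler_wpM2r ?(ltW (thk _))//.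
    have -> : M * c = 2 * M * c / theta * theta / 2 by field; rewrite gt_eqF.
    by rewrite ler_wpM2r// ler_wpM2r ?(ltW th0).
  rewrite !exprS expr0; lra.
have : c1 * c * W x <= S * theta ^+ k.+2 * (3 / 4) * W x by rewrite ler_wpM2r.
have : S * theta ^+ k.+2 / 4 <= S * theta ^+ k.+2 / 4 * W x.
  by rewrite ler_peMr// divr_ge0.
rewrite mulrA; lra.
Qed.

End growth.

(** * Lower bound on the growth of [Q^k 1] *)

Lemma integral_probability_one {R : realType} {d : measure_display}
  {X : measurableType d} (mu : probability X R) : (\int[mu]_x cst 1 x = 1)%E.
Proof. by rewrite integral_cst// mul1e; exact: probability_setT. Qed.

Section lower_growth.
Context {R : realType} {d : measure_display} {X : measurableType d}.
Context (Q : R.-ker X ~> X) (mu : probability X R).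
Context (W : X -> R) (eta : nat -> probability X R) (theta S : R).

(* Otherwise some rescaled iterates [g j] have summable [eta n]-integrals for
   all [n >= n0]. Irreducibility turns finiteness of their sum [eta n]-a.e. into finiteness [mu]-a.e.,
   so [g j] tends to [0] [mu]-a.e. and, being dominated by [W], in [mu]-mean,
   whereas stationarity keeps this mean equal to [1]. *)
Lemma Qpow_nonvanishing (n0 : nat) : 0 < theta -> 0 < S ->
  measurable_fun [set: X] W -> (forall x, 1 <= W x) ->
  (forall k x, (Qpow Q k (EFin \o W) x <= (S * theta ^+ k * W x)%:E)%E) ->
  (\int[mu]_x (W x)%:E < +oo)%E ->
  (forall n, (n0 <= n)%N -> (\int[eta n]_x (W x)%:E < +oo)%E) ->
  (forall A, measurable A -> (theta%:E * mu A = \int[mu]_x Q x A)%E) ->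
  (forall A, measurable A -> (forall n, (n0 <= n)%N -> eta n A = 0%E) ->
     forall x, Q x A = 0%E) ->
  exists N, exists2 c : R, 0 < c & forall k, exists2 n, (n0 <= n <= N)%N &
    ((c * theta ^+ k)%:E <= \int[eta n]_x Qpow Q k (cst 1%E) x)%E.
Proof.
move=> th0 S0 mW W1 growth muW etaW muQ irr; apply: contrapT => noN.
have W0 x : 0 <= W x by exact: le_trans (W1 x).
have thk j : 0 < theta ^+ j by exact: exprn_gt0.
have mEW : measurable_fun [set: X] (EFin \o W) by exact/measurable_EFinP.
have m1 : measurable_fun [set: X] (cst 1%E : X -> \bar R) by exact: measurable_cst.
have q0 k x : (0 <= Qpow Q k (cst 1%E) x)%E by exact: Qpow_ge0.
have mq k : measurable_fun [set: X] (Qpow Q k (cst 1%E)) by exact: measurable_Qpow.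
have qW k x : (Qpow Q k (cst 1%E) x <= (S * theta ^+ k * W x)%:E)%E.
  by apply: le_trans (growth k x); apply: le_Qpow => // y; rewrite lee_fin.
(* Failure with [N = j] and [c = 2^-(j+1)] produces an exponent [s j] at which all [eta n] with
   [n0 <= n <= j] give a small integral. *)
have [|s sP] := @choice nat nat (fun j k => forall n, (n0 <= n <= j)%N ->
    (\int[eta n]_x Qpow Q k (cst 1%E) x <= (1 / (2 ^ j.+1)%:R * theta ^+ k)%:E)%E).
  move=> j; apply: contrapT => nok; apply: noN; exists j.
  exists (1 / (2 ^ j.+1)%:R); first by rewrite divr_gt0// ltr0n expn_gt0.
  move=> k; apply: contrapT => non; apply: nok; exists k => n nj.
  rewrite leNgt; apply/negP => lt; apply: non; exists n => //; exact: ltW.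
pose g j x := ((theta ^+ s j)^-1%:E * Qpow Q (s j) (cst 1%E) x)%E.
have thV j : 0 <= (theta ^+ j)^-1 by rewrite invr_ge0 ltW.
have g0 j x : (0 <= g j x)%E by rewrite mule_ge0// lee_fin.
have mg j : measurable_fun [set: X] (g j) by exact: measurable_funeM.
have gW j x : (g j x <= (S * W x)%:E)%E.
  apply: le_trans (lee_wpmul2l _ (qW (s j) x)) _; first by rewrite lee_fin.
  by rewrite -EFinM lee_fin mulrA (mulrCA _ S) mulVf ?mulr1// gt_eqF.
have intg (nu : {measure set X -> \bar R}) j : (\int[nu]_x g j x =
    (theta ^+ s j)^-1%:E * \int[nu]_x Qpow Q (s j) (cst 1%E) x)%E.
  by rewrite ge0_integralZl// lee_fin.
pose G x := (\sum_(j <oo) g j x)%E.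
have G0 x : (0 <= G x)%E by exact: nneseries_ge0.
have mG : measurable_fun [set: X] G by exact: ge0_emeasurable_sum.
have etaG n : (n0 <= n)%N -> (\int[eta n]_x G x < +oo)%E.
  move=> n0n; rewrite integral_nneseries//.
  pose w := fine (\int[eta n]_x (W x)%:E).
  have wE : (\int[eta n]_x (W x)%:E = w%:E)%E.
    by rewrite fineK// ge0_fin_numE ?etaW// integral_ge0// => x _; rewrite lee_fin.
  have w0 : 0 <= w by apply/fine_ge0/integral_ge0 => x _; rewrite lee_fin.
  (* For [j >= n] the choice of [s j] gives a geometric term, covered by the [1]. The finitely many
     [j < n] only have the domination bound [S * w], which the second term absorbs because
     [2^(j+1) <= 2^n]. *)
  pose D := 1 + S * w * (2 ^ n)%:R.
  have Sw : 0 <= S * w by rewrite mulr_ge0// ltW.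
  have Sw2 : 0 <= S * w * (2 ^ n)%:R by rewrite mulr_ge0.
  have D0 : 0 <= D by rewrite addr_ge0.
  apply: (@le_lt_trans _ _ (\sum_(j <oo) (D / (2 ^ j.+1)%:R)%:E)%E); last first.
    by apply: le_lt_trans (epsilon_trick0 _ _) _; rewrite ?ltry.
  apply: lee_nneseries => [j _ _|j _]; first exact: integral_ge0.
  have [nj|jn] := leqP n j.
    rewrite intg; apply: le_trans (lee_wpmul2l _ (sP j n _)) _.
    - by rewrite lee_fin.
    - by rewrite n0n.
    rewrite -EFinM lee_fin mulrCA mulVf ?gt_eqF// mulr1 ler_wpM2r ?invr_ge0//.
    by rewrite /D lerDl.
  apply: (@le_trans _ _ (\int[eta n]_x (S%:E * (W x)%:E))%E).
    by apply: ge0_le_integral => //; exact: measurable_funeM.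
  rewrite ge0_integralZl// ?lee_fin ?(ltW S0)//; last by move=> x _; rewrite lee_fin.
  rewrite wE -EFinM lee_fin ler_pdivlMr ?ltr0n ?expn_gt0//.
  rewrite (@le_trans _ _ (S * w * (2 ^ n)%:R))//; last by rewrite /D lerDr.
  by rewrite ler_wpM2l// ler_nat leq_exp2l.
pose A := G @^-1` [set +oo%E].
have mA : measurable A by rewrite -[A]setTI; exact: mG.
have etaA n : (n0 <= n)%N -> eta n A = 0%E.
  move=> n0n.
  have /integrable_ae : (eta n).-integrable [set: X] G.
    apply/integrableP; split => //; under eq_integral do rewrite gee0_abs//.
    exact: etaG.
  move=> /(_ measurableT) [Z [mZ Z0 sub]].
  apply/eqP; rewrite eq_le measure_ge0 andbT -Z0 le_measure ?inE//.
  by move=> x /= Gx; apply: sub => /= /(_ Logic.I); rewrite Gx.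
(* By irreducibility [Q x A = 0] for every [x], and stationarity carries this over to [mu]. *)
have muA : mu A = 0%E.
  have := muQ _ mA; rewrite integral0_eq; last by move=> x _; exact: irr.
  by move/eqP; rewrite mule_eq0 => /orP[|/eqP//]; rewrite eqe gt_eqF.
have gcvg : {ae mu, forall x, [set: X] x -> g ^~ x @ \oo --> 0%E}.
  exists A; split => // x /= /not_implyP[_ ngx]; apply: contrapT => Gx; apply: ngx.
  have Gfin : (G x < +oo)%E by rewrite ltey; exact/eqP.
  apply: (squeeze_cvge _ (cvg_cst _) (nneseries_tail_cvg Gfin _)) => //.
  apply: nearW => j; rewrite g0/=.
  by rewrite (@nneseries_split _ (g ^~ x) j 1)// addn1 big_nat1 leeDl// nneseries_ge0.
have iSW : mu.-integrable [set: X] (fun x => (S * W x)%:E).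
  apply/integrableP; split; first exact/measurable_EFinP/measurable_funM.
  under eq_integral do rewrite gee0_abs ?lee_fin ?mulr_ge0 ?(ltW S0)// EFinM.
  rewrite ge0_integralZl// ?lee_fin ?(ltW S0)//; last by move=> x _; rewrite lee_fin.
  by rewrite lte_mul_pinfty// ?lee_fin ltW.
have gdom : {ae mu, forall x n, [set: X] x -> (`|g n x| <= (S * W x)%:E)%E}.
  by apply: aeW => x n _; rewrite gee0_abs.
have [_ _] := dominated_convergence measurableT mg (measurable_cst 0%E) gcvg iSW gdom.
rewrite integral0 (_ : [sequence _]_n = cst 1%E); last first.
  apply/funext => j /=; rewrite intg (integral_Qpow (ltW th0) muQ)//.
  by rewrite integral_probability_one mule1 -EFinM mulVf// gt_eqF.
move=> /(cvg_lim (@ereal_hausdorff R)); rewrite lim_cst//.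
by move=> /eqP; rewrite eqe oner_eq0.
Qed.

Lemma probability_exhaustion_gt0 (K : nat -> set X) :
  (forall n, measurable (K n)) -> (forall n m, (n <= m)%N -> K n `<=` K m) ->
  (forall x, exists n, K n x) -> exists n, (0 < mu (K n))%E.
Proof.
move=> mK Kle Kx.
have KT : \bigcup_n K n = [set: X].
  by apply/seteqP; split => // x _; have [n Knx] := Kx x; exists n.
have mKT : measurable (\bigcup_n K n) by rewrite KT.
have ndK : nondecreasing_seq K by move=> n m nm; apply/subsetPset; exact: Kle.
have := nondecreasing_cvg_mu (mu := mu) mK mKT ndK.
rewrite KT [X in _ --> X](_ : _ = 1%E); last exact: probability_setT.
move=> /(_ [set y | (0 < y)%E]) [|n _ /(_ n (leqnn n))]; last by exists n.
by apply: open_ereal_gt'; rewrite lte_fin.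
Qed.

End lower_growth.

Lemma ge0_le_integral_minorization {R : realType} {d : measure_display}
    {X : measurableType d} (nu m : {measure set X -> \bar R}) (a : R) (f : X -> \bar R) :
  0 <= a -> (forall A, measurable A -> (a%:E * nu A <= m A)%E) ->
  (forall x, 0 <= f x)%E -> measurable_fun [set: X] f ->
  (a%:E * \int[nu]_x f x <= \int[m]_x f x)%E.
Proof.
move=> a0 num f0 mf; rewrite -(ge0_integral_mscale _ _ (NngNum a0))//.
exact: ge0_le_measure_integral.
Qed.

Lemma exists_lower_bound_upto {R : realType} (u : nat -> R) N : (forall n, 0 < u n) ->
  exists2 a, 0 < a & forall n, (n <= N)%N -> a <= u n.
Proof.
move=> u0; elim: N => [|N [a a0 au]]; first by exists (u 0%N) => // -[].
exists (Num.min a (u N.+1)); first by rewrite lt_min a0 u0.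
by move=> n; rewrite leq_eqVlt ge_min => /predU1P[->|/au ->]//; rewrite lexx orbT.
Qed.

(** One further application of [Q] transfers the bound from [eta n] to [nu]: some [K n0] has
    positive [nu]-mass, and on it [Q^(k+1) 1] is at least [alpha n] times the [eta n]-integral of
    [Q^k 1]. The index [n] varies with [k] but stays at most [N], so these [alpha n] have a common
    positive lower bound. *)
Lemma Qpow_lower_growth {R : realType} {d : measure_display} {X : measurableType d}
    (Q : R.-ker X ~> X) (mu nu : probability X R) (W : X -> R)
    (K : nat -> set X) (eta : nat -> probability X R) (alpha : nat -> R) (theta S : R) :
  0 < theta -> 0 < S ->
  measurable_fun [set: X] W -> (forall x, 1 <= W x) ->
  (forall n, measurable (K n)) -> (forall n m, (n <= m)%N -> K n `<=` K m) ->
  (forall x, exists n, K n x) ->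
  (forall k x, (Qpow Q k (EFin \o W) x <= (S * theta ^+ k * W x)%:E)%E) ->
  (\int[mu]_x (W x)%:E < +oo)%E ->
  (forall A, measurable A -> (theta%:E * mu A = \int[mu]_x Q x A)%E) ->
  (forall n, 0 < alpha n) ->
  (forall n x, K n x ->
    forall A, measurable A -> ((alpha n)%:E * eta n A <= Q x A)%E) ->
  (forall n0 A, measurable A -> (forall n, (n0 <= n)%N -> eta n A = 0%E) ->
     forall x, Q x A = 0%E) ->
  exists2 c : R, 0 < c &
    forall k, ((c * theta ^+ k)%:E <= \int[nu]_x Qpow Q k (cst 1%E) x)%E.
Proof.
move=> th0 S0 mW W1 mK Kle Kcov growth muW muQ a0 minor irr.
have mEW : measurable_fun [set: X] (EFin \o W) by exact/measurable_EFinP.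
have W0 x : 0 <= W x by exact: le_trans (W1 x).
have m1 : measurable_fun [set: X] (cst 1%E : X -> \bar R) by exact: measurable_cst.
have [n0 nuK] := probability_exhaustion_gt0 nu mK Kle Kcov.
have [x0 Kx0] : exists x, K n0 x.
  apply: contrapT => noK; move: nuK; rewrite (_ : K n0 = set0) ?measure0 ?ltxx//.
  by apply/seteqP; split => // x Kx; apply: noK; exists x.
(* A single point of [K n0] suffices: [alpha n] times the [eta n]-integral of [W] is at most [Q W]
   at [x0], which is finite. *)
have etaW n : (n0 <= n)%N -> (\int[eta n]_x (W x)%:E < +oo)%E.
  move=> n0n; rewrite -(@lte_pmul2l _ (alpha n)%:E) ?lte_fin//.
  rewrite gt0_muley ?lte_fin//.
  apply: le_lt_trans (ge0_le_integral_minorization (ltW (a0 n))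
    (minor n x0 (Kle _ _ n0n _ Kx0)) _ mEW) _; first by move=> x; rewrite lee_fin.
  by apply: le_lt_trans (growth 1%N x0) _; rewrite ltry.
have [N [c c0 cP]] := Qpow_nonvanishing th0 S0 mW W1 growth muW etaW muQ (irr n0).
have [a aP1 aP2] := exists_lower_bound_upto N a0.
pose p := fine (nu (K n0)).
have pE : nu (K n0) = p%:E by rewrite fineK// fin_num_measure.
have p0 : 0 < p by rewrite -lte_fin -pE.
(* The [1] covers [k = 0]; dividing by [theta] makes up for the shift when the bound at [k] is used
   for [k.+1]. *)
exists (Num.min 1 (a * c * p / theta)).
  by rewrite lt_min ltr01 divr_gt0// !mulr_gt0.
case=> [|k].
  rewrite integral_probability_one lee_fin expr0 mulr1.
  by rewrite ge_min lexx.
have [n /andP[n0n nN] cn] := cP k.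
have q0 x : (0 <= Qpow Q k (cst 1%E) x)%E by exact: Qpow_ge0.
have mq : measurable_fun [set: X] (Qpow Q k (cst 1%E)) by exact: measurable_Qpow.
apply: (@le_trans _ _ (\int[nu]_x ((a * c * theta ^+ k)%:E * (\1_(K n0) x)%:E))%E).
  rewrite ge0_integralZl//; last 2 first.
  - by apply/measurable_EFinP; exact: measurable_indic.
  - by rewrite lee_fin !mulr_ge0// ?exprn_ge0// ltW.
  rewrite integral_indic// setIT [X in (_ * X)%E](_ : _ = p%:E); last exact: pE.
  rewrite -EFinM lee_fin.
  apply: (@le_trans _ _ (a * c * p / theta * theta ^+ k.+1)).
    by rewrite ler_wpM2r ?exprn_ge0// ?(ltW th0)// ge_min lexx orbT.
  by rewrite exprS mulrA divfK ?gt_eqF// mulrAC.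
apply: ge0_le_integral => //.
- by move=> x _; rewrite -EFinM lee_fin mulr_ge0// !mulr_ge0// ?exprn_ge0// ltW.
- by apply: measurable_funeM; apply/measurable_EFinP; exact: measurable_indic.
- exact: measurable_Qpow.
move=> x _; rewrite indicE; have [Kx|Kx] := boolP (x \in K n0); last first.
  by rewrite mule0; exact: (Qpow_ge0 Q k.+1).
rewrite mule1; move: Kx; rewrite inE => Kx.
apply: le_trans (ge0_le_integral_minorization (ltW (a0 n))
    (minor n x (Kle _ _ n0n _ Kx)) q0 mq).
apply: le_trans (lee_wpmul2l _ cn); last by rewrite lee_fin ltW.
by rewrite -EFinM lee_fin -mulrA ler_wpM2r ?aP2// mulr_ge0 ?exprn_ge0// ltW.
Qed.

(** * From geometric bounds to logarithmic rates *)

Lemma cvg_ln_rate {R : realType} (a : nat -> R) (theta c C : R) :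
  0 < theta -> 0 < c ->
  (forall k, c * theta ^+ k <= a k <= C * theta ^+ k) ->
  (fun k => k%:R^-1 * ln (a k)) @ \oo --> ln theta.
Proof.
(* At index [0] the inverse is [0] by convention and the identity [rate] below need not hold, so the
   limit is taken along [k.+1]. *)
move=> th0 c0 aP; rewrite -cvg_shiftS.
have thk k : 0 < theta ^+ k by exact: exprn_gt0.
have C0 : 0 < C.
  have /andP[+ +] := aP 0%N; rewrite expr0 !mulr1 => ca aC.
  exact: lt_le_trans c0 (le_trans ca aC).
have lim r : (fun k => harmonic k * ln r + ln theta) @ \oo --> ln theta.
  rewrite -[X in _ --> X]add0r; apply: cvgD; last exact: cvg_cst.
  by rewrite -[X in _ --> X](mul0r (ln r)); apply: cvgMl; exact: cvg_harmonic.
apply: squeeze_cvgr (lim c) (lim C); apply: nearW => k /=.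
have /andP[ca aC] := aP k.+1.
have rate r : 0 < r -> k.+1%:R^-1 * ln r + ln theta = k.+1%:R^-1 * ln (r * theta ^+ k.+1).
  move=> r0; rewrite lnM ?posrE// lnXn// mulrDr; congr (_ + _).
  by rewrite -[ln theta *+ _]mulr_natl mulKf.
have ak : 0 < a k.+1 by apply: lt_le_trans ca; rewrite mulr_gt0.
by rewrite !rate// !ler_wpM2l ?invr_ge0// ler_ln ?posrE// mulr_gt0.
Qed.

(** * Operator norms on the weighted space *)

Section operator_norm.
Context {R : realType} {d : measure_display} {X : measurableType d}.
Context (Q : R.-ker X ~> X) (W : X -> R).

Lemma normW_ub (f : X -> \bar R) (c : R) : (forall x, 0 < W x) ->
  (normW W f <= c%:E)%E <-> (forall x, `|f x| <= (c * W x)%:E)%E.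
Proof.
move=> W0.
have normE x : (`|f x| * (W x)^-1%:E <= c%:E)%E = (`|f x| <= (c * W x)%:E)%E.
  by rewrite EFinM lee_pdivrMr.
split => [fc x|fc].
  rewrite -normE; apply: le_trans fc.
  by apply: ereal_sup_ubound; exists x.
by apply: ge_ereal_sup => _ [x _ <-]; rewrite normE.
Qed.

(** Positivity gives [|Q^k phi| <= Q^k |phi| <= Q^k W] on the unit ball, so [W] is the extremal test
    function. *)
Lemma opnormW_le k (c : R) : measurable_fun [set: X] W -> (forall x, 0 < W x) ->
  (forall x, Qpow Q k (EFin \o W) x <= (c * W x)%:E)%E ->
  (opnormW Q W k <= c%:E)%E.
Proof.
move=> mW W0 Qc; apply: ge_ereal_sup => _ [phi [[mphi _] phi1] <-].
have mEphi : measurable_fun [set: X] (EFin \o phi) by exact/measurable_EFinP.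
apply/(normW_ub _ _ W0) => x; apply: le_trans (le_abse_Qpow _ _ _ mEphi) _.
apply: le_trans (Qc x); apply: le_Qpow => //.
- exact: measurableT_comp.
- exact/measurable_EFinP.
- by move=> y; exact: abse_ge0.
- by move=> y; have /(normW_ub _ _ W0)/(_ y) := phi1; rewrite mul1r.
Qed.

Lemma normW_Qpow_le_opnormW k :
  measurable_fun [set: X] W -> (forall x, 0 < W x) ->
  (normW W (Qpow Q k (EFin \o W)) <= opnormW Q W k)%E.
Proof.
move=> mW W0; apply: ereal_sup_ubound; exists W => //; split.
  by split=> //; exists 1 => y; rewrite mul1r gtr0_norm.
by apply/(normW_ub _ _ W0) => y; rewrite mul1r gee0_abs// lee_fin ltW.
Qed.

(** With [c] the norm, [Q^k W <= c W]; integrating against [mu] gives [theta^k mu(W) <= c mu(W)],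
    where [mu(W)] is finite and at least [1] and hence cancels. *)
Lemma opnormW_lower_bound (mu : probability X R) (theta : R) k : 0 <= theta ->
  measurable_fun [set: X] W -> (forall x, 1 <= W x) ->
  (\int[mu]_x (W x)%:E < +oo)%E ->
  (forall A, measurable A -> (theta%:E * mu A = \int[mu]_x Q x A)%E) ->
  (opnormW Q W k < +oo)%E -> theta ^+ k <= fine (opnormW Q W k).
Proof.
move=> th0 mW W1 muW muQ opfin.
have W0 x : 0 < W x by exact: lt_le_trans (W1 x).
have mEW : measurable_fun [set: X] (EFin \o W) by exact/measurable_EFinP.
have EW0 x : (0 <= (EFin \o W) x)%E by rewrite lee_fin ltW.
have op0 : (0 <= opnormW Q W k)%E.
  apply: le_trans (normW_Qpow_le_opnormW k mW W0).
  apply: (@le_trans _ _ (`|Qpow Q k (EFin \o W) point| * (W point)^-1%:E)%E).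
    by rewrite mule_ge0// lee_fin invr_ge0 ltW.
  by apply: ereal_sup_ubound; exists point.
pose c := fine (opnormW Q W k).
have cE : opnormW Q W k = c%:E by rewrite fineK// ge0_fin_numE.
have c0 : 0 <= c by exact: fine_ge0.
have QW : forall x, (Qpow Q k (EFin \o W) x <= (c * W x)%:E)%E.
  move=> x; apply: le_trans (lee_abs _) _; apply: (proj1 (normW_ub _ c W0)).
  by rewrite -cE; exact: normW_Qpow_le_opnormW.
have I1 : (1 <= \int[mu]_x (W x)%:E)%E.
  rewrite -(integral_probability_one mu); apply: ge0_le_integral => //.
  by move=> x _; rewrite lee_fin.
pose I := fine (\int[mu]_x (W x)%:E).
have IE : (\int[mu]_x (W x)%:E = I%:E)%E.
  by rewrite fineK// ge0_fin_numE// (le_trans _ I1).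
have I0 : 0 < I by rewrite -lte_fin -IE; exact: lt_le_trans I1.
rewrite -(ler_pM2r I0) -lee_fin !EFinM -IE -(integral_Qpow th0 muQ)//.
rewrite -ge0_integralZl ?lee_fin//; last by move=> x _; exact: EW0.
apply: ge0_le_integral => //.
- by move=> x _; exact: Qpow_ge0.
- exact: measurable_Qpow.
- exact: measurable_funeM.
Qed.

End operator_norm.

(** * Compact sets of a Polish space are Borel *)

Lemma polish_hausdorff {R : realType} {T : ptopologicalType} :
  polish R T -> hausdorff_space T.
Proof.
move=> [_ [dist [d0 [deq [dsym [dtri [dopen _]]]]]]].
have ballo x (e : R) : open [set y | dist x y < e].
  apply/dopen => y /= xy; exists (e - dist x y); first by rewrite subr_gt0.
  move=> z /= yz; apply: le_lt_trans (dtri x y z) _; lra.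
move=> x y xy; apply/deq; apply: contrapT => /eqP dxy.
have dp : 0 < dist x y by rewrite lt_neqAle eq_sym dxy d0.
have nb z : nbhs z [set v | dist z v < dist x y / 2].
  apply: open_nbhs_nbhs; split; first exact: ballo.
  by rewrite /= (proj2 (deq z z) erefl) divr_gt0.
have [z [/= xz yz]] := xy _ _ (nb x) (nb y).
have := dtri x z y; rewrite (dsym z y); lra.
Qed.

Lemma compact_borel_measurable {R : realType} {T : ptopologicalType} (C : set T) :
  polish R T -> compact C -> (measurable : set (set (borel T))) C.
Proof.
move=> /polish_hausdorff hT /(compact_closed hT)/closed_openC oC.
by rewrite -(setCK C); apply: measurableC; exact: sub_sigma_algebra.
Qed.

(** * Identification of the spectral radius and the growth rate *)

Theorem theorem2 (R : realType) (T : ptopologicalType)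
  (Q : R.-ker (borel T) ~> (borel T))
  (K : nat -> set T) (W : borel T -> R)
  (gamma b : nat -> R) (eta : nat -> probability (borel T) R) (alpha : nat -> R)
  (Lambda : R) (mustar : probability (borel T) R) :
  polish R T ->
  (* Q^f(x, .) has finite mass *)
  (forall x : borel T, (Q x setT < +oo)%E) ->
  (* the compact exhaustion (K_n) *)
  (forall n, compact (K n)) ->
  (forall n m, (n <= m)%N -> K n `<=` K m) ->
  (forall C : set T, compact C -> exists m, C `<=` K m) ->
  (* Assumption 1 (Lyapunov) *)
  measurable_fun [set: borel T] W ->
  (forall x, 1 <= W x) ->
  (forall C : set T, compact C -> exists M : R, forall x, C x -> W x <= M) ->
  (forall n, 0 < gamma n) -> (forall n, 0 < b n) ->
  gamma @ \oo --> 0 ->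
  (forall n (x : borel T),
     (Qapp Q (EFin \o W) x <= (gamma n * W x + b n * \1_(K n) x)%:E)%E) ->
  (* Assumption 2 (minorization and irreducibility) *)
  (forall n, 0 < alpha n) ->
  (forall n (x : borel T), K n x ->
     forall A : set (borel T), measurable A -> ((alpha n)%:E * eta n A <= Q x A)%E) ->
  (forall (n0 : nat) (phi : borel T -> R), inLW W phi -> (forall x, 0 <= phi x) ->
     (forall n, (n0 <= n)%N -> (\int[eta n]_y (phi y)%:E = 0)%E) ->
     forall x, Qapp Q (EFin \o phi) x = 0%E) ->
  (* Assumption 3 (local regularity) *)
  (forall n (phi : borel T -> R), measurable_fun [set: borel T] phi ->
     (exists M : R, forall x, K n x -> `|phi x| <= M) ->
     {within K n, continuous
        (fun x : T => fine (Qapp Q (fun y => (phi y * \1_(K n) y)%:E) x))}) ->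
  (* Lambda > 0 is the spectral radius of Q^f on L^\infty_W *)
  0 < Lambda ->
  (fun k : nat => fine (opnormW Q W k.+1) `^ (k.+1%:R)^-1) @ \oo --> Lambda ->
  (* mustar is a fixed point of the Feynman-Kac map with mustar(W) < +oo *)
  (\int[mustar]_x (W x)%:E < +oo)%E ->
  (forall A : set (borel T), measurable A ->
     mustar A = (\int[mustar]_x Q x A / \int[mustar]_x Q x setT)%E) ->
  (forall mu : probability (borel T) R, (\int[mu]_x (W x)%:E < +oo)%E ->
     (fun k : nat => k%:R^-1 * ln (fine (\int[mu]_x Qpow Q k (cst 1%E) x)))
       @ \oo --> ln Lambda)
  /\ (Lambda%:E = \int[mustar]_x Q x setT)%E.
Proof.
move=> polT Qfin cK Kle Kexh mW W1 WC g0 b0 gcvg lyap a0 minor irr.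
move=> reg _ specrad piW fixpt.
have mK n : (measurable : set (set (borel T))) (K n).
  exact: compact_borel_measurable polT (cK n).
have Kcov (x : T) : exists n, K n x.
  by have [n xK] := Kexh [set x] (@compact_set1 _ x); exists n; exact: xK.
have W0 x : 0 < W x by exact: lt_le_trans (W1 x).
(* In the extended reals [0 / 0] and [+oo / +oo] both evaluate to [0], so the fixed-point equation
   on the whole space, of mass [1], excludes both values. *)
have [theta th0 thE] : exists2 theta : R, 0 < theta &
    (\int[mustar]_x Q x setT = theta%:E)%E.
  have := fixpt _ (@measurableT _ (borel T)).
  have : (0 <= \int[mustar]_x Q x setT)%E by exact: integral_ge0.
  have := probability_setT mustar => /= ->.
  case: (\int[mustar]_x Q x setT)%E => [r| |]//=; last first.
    by rewrite invey mule0 => _ /eqP; rewrite eqe oner_eq0.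
  rewrite lee_fin le_eqVlt => /predU1P[<-|r0 _]; last by exists r.
  by rewrite mul0e => /eqP; rewrite eqe oner_eq0.
have piQ (A : set (borel T)) : measurable A ->
    (theta%:E * mustar A = \int[mustar]_x Q x A)%E.
  move=> mA; rewrite fixpt// thE muleCA inver gt_eqF// -EFinM.
  by rewrite mulfV ?gt_eqF// mule1.
have irrA n0 (A : set (borel T)) : measurable A ->
    (forall n, (n0 <= n)%N -> eta n A = 0%E) -> forall x, Q x A = 0%E.
  move=> mA etaA x; have := irr n0 (\1_A : borel T -> R).
  move=> /(_ _ _ _ x); rewrite /Qapp integral_indic// setIT; apply.
  - split; first exact: measurable_indic.
    exists 1 => y; rewrite mul1r (le_trans _ (W1 y))// indicE.
    by case: (_ \in _); rewrite ?normr1 ?normr0.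
  - by move=> y; rewrite indicE; case: (_ \in _).
  - by move=> n /etaA <-; rewrite integral_indic// setIT.
(* Take [K n0] of positive [mustar]-mass. If [eta n A > 0] for some [n >= n0], minorization on
   [K n0] makes the [mustar]-integral of [Q x A] positive, against stationarity; so irreducibility
   applies. *)
have dom (A : set (borel T)) : measurable A -> mustar A = 0%E ->
    forall x, Q x A = 0%E.
  move=> mA piA; have [n0 piK] := probability_exhaustion_gt0 mustar mK Kle Kcov.
  apply: (irrA n0) => // n n0n; apply/eqP; rewrite eq_le measure_ge0 andbT leNgt.
  apply/negP => etaA.
  suff : (0 < \int[mustar]_x Q x A)%E by rewrite -piQ// piA mule0 ltxx.
  apply: (@lt_le_trans _ _ (\int[mustar]_x (((alpha n)%:E * eta n A) *
      (\1_(K n0) x)%:E))%E).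
    rewrite ge0_integralZl//; last 2 first.
    - by apply/measurable_EFinP; exact: measurable_indic.
    - by rewrite mule_ge0// lee_fin ltW.
    by rewrite integral_indic// setIT !mule_gt0// lte_fin.
  apply: ge0_le_integral => //.
  - by move=> x _; rewrite mule_ge0// ?mule_ge0// lee_fin// ltW.
  - by apply: measurable_funeM; apply/measurable_EFinP; exact: measurable_indic.
  - exact: measurable_kernel.
  move=> x _; rewrite indicE; have [Kx|Kx] := boolP (x \in K n0).
    by rewrite mule1 minor//; apply: Kle n0n _ _; rewrite inE in Kx.
  by rewrite mule0.
have uac n (e : R) : 0 < e -> exists2 delta : R, 0 < delta &
    forall A : set (borel T), measurable A -> (mustar A <= delta%:E)%E ->
    forall x, K n x -> (Q x (A `&` K n) <= e%:E)%E.
  apply: kernel_uniformly_absolutely_continuous => // A mA.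
  (* Local regularity for the indicator of [A] is continuity on [K n] of the mass that [Q x] gives
     to the part of [A] inside [K n]. *)
  have mA1 : measurable_fun [set: borel T] (\1_A : borel T -> R).
    exact: measurable_indic.
  have A1 : exists M : R, forall x, K n x -> `|(\1_A : borel T -> R) x| <= M.
    by exists 1 => x _; rewrite indicE; case: (_ \in _); rewrite ?normr1 ?normr0.
  have := reg n _ mA1 A1; rewrite [X in {within _, continuous X}](_ : _ =
    (fun x : T => fine (Q x (A `&` K n))))//.
  apply/funext => x; rewrite /Qapp -[in RHS](setIT (A `&` K n)).
  rewrite -integral_indic//; last exact: measurableI.
  by rewrite indicI.
have [S S0 growth] := Qpow_growth th0 mW W1 mK (fun n => WC _ (cK n)) g0 b0 gcvg
  lyap piW piQ uac.
have opS k : (opnormW Q W k <= (S * theta ^+ k)%:E)%E by exact: opnormW_le.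
have -> : Lambda = theta.
  have opP k : 1 * theta ^+ k <= fine (opnormW Q W k) <= S * theta ^+ k.
    have opfin : (opnormW Q W k < +oo)%E by apply: le_lt_trans (opS k) _; rewrite ltry.
    rewrite mul1r (opnormW_lower_bound (ltW th0) mW W1 piW piQ opfin)/=.
    by case: (opnormW Q W k) (opS k) => //= _; rewrite mulr_ge0 ?exprn_ge0// ltW.
  have := cvg_ln_rate th0 ltr01 opP; rewrite -cvg_shiftS => ratecvg.
  have powcvg : (fun k : nat => fine (opnormW Q W k.+1) `^ (k.+1%:R)^-1) @ \oo --> theta.
    rewrite -[X in _ --> X](@lnK _ theta) ?posrE//.
    (* The root is the exponential of the logarithmic rate once the norm is nonzero, which the lower
       bound [theta^k] guarantees. *)
    rewrite (_ : (fun _ => _) =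
        (fun k => expR (k.+1%:R^-1 * ln (fine (opnormW Q W k.+1))))); last first.
      apply/funext => k; have /andP[opk _] := opP k.+1; rewrite /powR gt_eqF//.
      by apply: lt_le_trans opk; rewrite mul1r exprn_gt0.
    exact: continuous_cvg (@continuous_expR R (ln theta)) ratecvg.
  by apply: cvg_unique specrad powcvg; exact: Rhausdorff.
split => // mu muW.
have [c c0 lower] := Qpow_lower_growth mu th0 S0 mW W1 mK Kle Kcov growth piW piQ
  a0 minor irrA.
pose I := fine (\int[mu]_x (W x)%:E).
have IE : (\int[mu]_x (W x)%:E = I%:E)%E.
  by rewrite fineK// ge0_fin_numE// integral_ge0// => x _; rewrite lee_fin ltW.
have mEW : measurable_fun [set: borel T] (EFin \o W) by exact/measurable_EFinP.
apply: (cvg_ln_rate (c := c) (C := S * I)) => // k.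
(* Here [1 <= W] reduces the claim to [growth] integrated against [mu]. *)
have upper : (\int[mu]_x Qpow Q k (cst 1%E) x <= (S * I * theta ^+ k)%:E)%E.
  rewrite mulrAC EFinM -IE -ge0_integralZl//; last 2 first.
  - by move=> x _; rewrite lee_fin ltW.
  - by rewrite lee_fin mulr_ge0 ?exprn_ge0// ltW.
  apply: ge0_le_integral => //.
  - by move=> x _; exact: Qpow_ge0.
  - by apply: measurable_Qpow; exact: measurable_cst.
  - exact: measurable_funeM.
  move=> x _; rewrite -EFinM; apply: le_trans (growth k x).
  by apply: le_Qpow => // y; rewrite lee_fin.
rewrite -!lee_fin fineK ?lower//.
rewrite ge0_fin_numE ?(le_lt_trans upper) ?ltry//.
by apply: integral_ge0 => x _; exact: Qpow_ge0.
Qed.
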